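(* Let $n\ge1$, $q\in[1,\infty]$, $s\in\mathbb{R}$, let $\mathbb{B}^n$ be the unit ball of $\mathbb{R}^n$, let $q_n=\frac{2(n+1)}{n-1}$ (with $q_1=\infty$), and $$s_{n,q}=\max\left\{n\left(\tfrac12-\tfrac1q\right),\ \tfrac{n+1}{4}-\tfrac{n-1}{2q}\right\}.$$ Consider, for all $f\in H^s(\mathbb{R}^n)$ and a constant $C_{n,q,s}$ independent of $f$, the estimates (i) $\|\sup_{0<t<1}|e^{\pm it\sqrt{-\Delta}}f|\|_{L^q(\mathbb{R}^n)}\le C_{n,q,s}\|f\|_{H^s(\mathbb{R}^n)}$; (ii) $\|\sup_{t\in\mathbb{R}}|e^{\pm it\sqrt{-\Delta}}f|\|_{L^q(\mathbb{R}^n)}\le C_{n,q,s}\|f\|_{H^s(\mathbb{R}^n)}$; (iii) $\|\sup_{0<t<1}|e^{\pm it\sqrt{-\Delta}}f|\|_{L^q(\mathbb{B}^n)}\le C_{n,q,s}\|f\|_{H^s(\mathbb{R}^n)}$; (iv) $\|\sup_{t\in\mathbb{R}}|e^{\pm it\sqrt{-\Delta}}f|\|_{L^q(\mathbb{B}^n)}\le C_{n,q,s}\|f\|_{H^s(\mathbb{R}^n)}$. If (i) holds, then $q\in[2,\infty]$ and $s\ge s_{n,q}$. If (ii) holds, then $q\in[q_n,\infty]$ and $s\ge n(\frac12-\frac1q)$. If (iii) or (iv) holds, then $s\ge\max\{1/2,s_{n,q}\}$.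
   Context: For $f$ on $\mathbb{R}^n$, $\widehat f(\xi)=\int f(x)e^{-2\pi i x\cdot\xi}dx$, and $$e^{\pm it\sqrt{-\Delta}}f(x)=\int_{\mathbb{R}^n}\widehat f(\xi)e^{2\pi i(x\cdot\xi\pm t|\xi|)}\,d\xi .$$ $H^s(\mathbb{R}^n)$ has norm $\|f\|_{H^s}=\big(\int(1+|\xi|)^{2s}|\widehat f(\xi)|^2d\xi\big)^{1/2}$. *)

(* Defs.v *)
From mathcomp Require Import all_boot all_algebra.
From mathcomp Require Import all_classical all_reals all_analysis.
From mathcomp Require Import complex.
Import GRing.Theory Num.Theory ComplexField.

Set Implicit Arguments.
Unset Strict Implicit.
Unset Printing Implicit Defensive.

Local Open Scope classical_set_scope.
Local Open Scope ring_scope.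

Section WaveDefs.
Variable R : realType.

Definition dotn n (x y : n.-tuple R) : R := \sum_(i < n) tnth x i * tnth y i.
Definition normn n (x : n.-tuple R) : R := Num.sqrt (\sum_(i < n) tnth x i ^+ 2).

(* Lebesgue integral over R^n of a nonnegative (extended-real) function,
   written as the iterated integral (Tonelli) of one-dimensional Lebesgue
   integrals. *)
Fixpoint iint (n : nat) : (n.-tuple R -> \bar R) -> \bar R :=
  match n return (n.-tuple R -> \bar R) -> \bar R with
  | 0 => fun F => F [tuple]
  | m.+1 => fun F =>
      (\int[@lebesgue_measure R]_(t in [set: R])
          iint (fun y : m.-tuple R => F [tuple of t :: y]))%E
  end.

Definition lebn n (A : set (n.-tuple R)) : \bar R :=
  iint (fun x => (\1_A x)%:E).

Definition iintR n (F : n.-tuple R -> R) : R :=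
  fine (iint (fun x => (Num.max (F x) 0)%:E)) -
  fine (iint (fun x => (Num.max (- F x) 0)%:E)).

Definition iintC n (F : n.-tuple R -> R[i]) : R[i] :=
  (iintR (fun x => complex.Re (F x)) +i* iintR (fun x => complex.Im (F x)))%C.

Definition cmod (z : R[i]) : R :=
  Num.sqrt (complex.Re z ^+ 2 + complex.Im z ^+ 2).

Definition expi (a : R) : R[i] := (cos a +i* sin a)%C.

(* e^{± i t sqrt(-Δ)} f (x), expressed through fh = \hat f:
   \int fh(ξ) e^{2πi(x·ξ ± t|ξ|)} dξ ;  pm = true is '+', pm = false is '-'. *)
Definition wave_prop n (pm : bool) (fh : n.-tuple R -> R[i])
  (x : n.-tuple R) (t : R) : R[i] :=
  iintC (fun xi => fh xi *
     expi (2 * pi * (dotn x xi + (if pm then 1 else -1) * t * normn xi))).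

Definition wave_max n pm (T : set R) (fh : n.-tuple R -> R[i])
  (x : n.-tuple R) : \bar R :=
  ereal_sup [set (cmod (wave_prop pm fh x t))%:E | t in T].

Definition Lq_norm n (q : \bar R) (D : set (n.-tuple R))
  (F : n.-tuple R -> \bar R) : \bar R :=
  match q with
  | r%:E => ((iint (fun x => if `[< D x >] then (`|F x| `^ r)%E else 0%E))
               `^ r^-1)%E
  | _ =>
      ereal_inf [set M : \bar R |
                   lebn (fun x => D x /\ (M < `|F x|)%E) = 0%E]
  end.

(* H^s norm, in terms of fh = \hat f *)
Definition Hs_norm n (s : R) (fh : n.-tuple R -> R[i]) : \bar R :=
  ((iint (fun xi => (((1 + normn xi) `^ (2 * s)) * cmod (fh xi) ^+ 2)%:E))
     `^ (2^-1))%E.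

(* Admissible data: f in H^s(R^n) given through its Fourier transform fh,
   with fh measurable and integrable, so that the propagator is given
   pointwise by the formula above. *)
Definition admissible n (s : R) (fh : n.-tuple R -> R[i]) : Prop :=
  measurable_fun [set: n.-tuple R] (fun xi => complex.Re (fh xi)) /\
  measurable_fun [set: n.-tuple R] (fun xi => complex.Im (fh xi)) /\
  (iint (fun xi => (cmod (fh xi))%:E) < +oo)%E /\
  (Hs_norm s fh < +oo)%E.

Definition max_estimate n (q : \bar R) (s : R) (pm : bool) (T : set R)
  (D : set (n.-tuple R)) : Prop :=
  exists C : R, forall fh : n.-tuple R -> R[i], admissible s fh ->
    (Lq_norm q D (wave_max pm T fh) <= C%:E * Hs_norm s fh)%E.

Definition unit_ball n : set (n.-tuple R) := [set x | normn x < 1].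

Definition recip_q (q : \bar R) : R := if q is r%:E then r^-1 else 0.

Definition q_crit (n : nat) : \bar R :=
  if n == 1%N then +oo%E else ((2 * n.+1%:R) / (n.-1)%:R)%:E.

Definition s_crit (n : nat) (q : \bar R) : R :=
  Num.max (n%:R * (2^-1 - recip_q q)) (n.+1%:R / 4 - (n.-1)%:R / 2 * recip_q q).

End WaveDefs.

(* Main.v *)
(** Every necessary condition comes from testing the estimate on data whose
    Fourier transform is the indicator function of a frequency box B.  Whenever the
    phase x.xi ± t|xi| is at most 1/(2 pi) in absolute value on B, there is no
    cancellation and |e^{± it sqrt(-Delta)} f(x)| >= cos(1) |B|.  If this happens,
    for suitable t = t(x), on a space box E, then
    |B|^(1/2) |E|^(1/q) <= C P^s, where |xi| ~ P on B.

    With B = [A, 2A] x [0, del]^(n-1), and E of size L in x_0 and kappa/del in the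
    other variables, where L del^2 <= kappa A, letting N tend to infinity gives
    - s >= n(1/2 - 1/q)                     for A = del = N, L ~ 1/N (focusing);
    - s >= (n+1)/4 - (n-1)/(2q)             for A = N^2, del = N, L ~ 1 (Knapp);
    - s >= 1/2                              for A = N, del = 1, L ~ 1 (plane wave);
    - (n+1)/q <= (n-1)/2, that is q >= q_n, for A = 1, del = 1/N, L ~ N^2.
    The condition q >= 2 comes from B = [0, 1/N]^n and E of side ~ N. *)
Require Import Defs.
From mathcomp Require Import all_boot all_order all_algebra.
From mathcomp Require Import all_classical all_reals all_analysis.
From mathcomp Require Import measurable_realfun complex.
From mathcomp Require Import ring lra.
Import Order.TTheory GRing.Theory Num.Theory.
Local Open Scope classical_set_scope.
Local Open Scope ring_scope.

Set Implicit Arguments.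
Unset Strict Implicit.

(** * Monotonicity of iterated integrals, and integrals over boxes *)

Section IteratedIntegral.
Variable R : realType.

(** The integral of a nonnegative function is a supremum over the simple functions below it, so
    enlarging the function enlarges the supremum. This covers the maximal function, whose
    measurability is never established. *)
Lemma integral_ge0_le (f g : R -> \bar R) :
  (forall x, (0 <= f x)%E) -> (forall x, (f x <= g x)%E) ->
  (\int[@lebesgue_measure R]_x f x <= \int[@lebesgue_measure R]_x g x)%E.
Proof.
move=> f0 fg; have g0 x : (0 <= g x)%E by exact: le_trans (f0 x) (fg x).
rewrite !ge0_integralTE//; apply: ereal_sup_le => _ [h /= hf <-].
by exists h => // x; exact: le_trans (hf x) (fg x).
Qed.

Lemma iint_ge0 n (F : n.-tuple R -> \bar R) :
  (forall x, (0 <= F x)%E) -> (0 <= iint F)%E.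
Proof.
elim: n F => [|n IH] F F0 /=; first exact: F0.
by apply: integral_ge0 => t _; exact: IH.
Qed.

Lemma iint_le n (F G : n.-tuple R -> \bar R) :
  (forall x, (0 <= F x)%E) -> (forall x, (F x <= G x)%E) ->
  (iint F <= iint G)%E.
Proof.
elim: n F G => [|n IH] F G F0 FG /=; first exact: FG.
apply: integral_ge0_le => t; first exact: iint_ge0.
exact: IH.
Qed.

Definition box n (a b : nat -> R) : set (n.-tuple R) :=
  [set x | forall i : 'I_n, a i <= tnth x i <= b i].

Definition box_vol n (a b : nat -> R) : R := \prod_(i < n) (b i - a i).

Lemma box_cons n (a b : nat -> R) (t : R) (y : n.-tuple R) :
  box a b [tuple of t :: y] <->
  a 0%N <= t <= b 0%N /\ box (a \o S) (b \o S) y.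
Proof.
split=> [H|[H0 H] i].
  split; first by have := H ord0; rewrite tnth0.
  by move=> i; have := H (lift ord0 i); rewrite tnthS.
by case: (unliftP ord0 i) => [j|] ->; [rewrite tnthS; exact: H|rewrite tnth0].
Qed.

Lemma indic_box_cons n (a b : nat -> R) (t : R) (y : n.-tuple R) :
  \1_(box a b) [tuple of t :: y] =
  \1_`[a 0%N, b 0%N] t * \1_(box (a \o S) (b \o S)) y :> R.
Proof.
rewrite !indicE -natrM mulnb; congr (_ %:R); congr nat_of_bool.
apply/idP/idP; rewrite ?inE.
  by move=> /box_cons[? ?]; apply/andP; split; rewrite inE//= in_itv.
case/andP; rewrite !inE/= in_itv/= => H1 H2.
by apply/box_cons.
Qed.

(** The induction applies its hypothesis with [k] multiplied by the indicator of the first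
    coordinate's interval, hence the general factor [k]. *)
Lemma iint_box n (a b : nat -> R) (k : R) : 0 <= k ->
  (forall i, a i < b i) ->
  iint (fun x : n.-tuple R => (k * \1_(box a b) x)%:E) = (k * box_vol n a b)%:E.
Proof.
elim: n a b k => [|n IH] a b k k0 ab /=.
  rewrite /box_vol big_ord0 indicE mem_set//= => -[]//.
have -> : (\int[@lebesgue_measure R]_t
    iint (fun y : n.-tuple R => (k * \1_(box a b) [tuple of t :: y])%:E) =
    \int[@lebesgue_measure R]_t
     ((k * box_vol n (a \o S) (b \o S))%:E * (\1_`[a 0%N, b 0%N] t)%:E))%E.
  apply: eq_integral => t _.
  rewrite -EFinM mulrAC -IH ?mulr_ge0//; last by move=> i; exact: ab.
  by congr iint; apply/funext => y; rewrite indic_box_cons mulrA.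
rewrite ge0_integralZl_EFin ?integral_indic//.
- rewrite setIT /= lebesgue_measure_itv/= lte_fin ab -EFinB -EFinM.
  by rewrite /box_vol [in RHS]big_ord_recl /=; congr (_%:E); rewrite mulrAC -!mulrA.
- by apply/measurable_EFinP; exact: measurable_indic.
- by apply: mulr_ge0 => //; apply: prodr_ge0 => i _; rewrite subr_ge0 ltW /=.
Qed.

Lemma measurable_indic_box n (a b : nat -> R) (k : R) :
  measurable_fun [set: n.-tuple R] (fun x => k * \1_(box a b) x).
Proof.
apply: measurable_funM => //; apply: measurable_indic.
have -> : box a b = \bigcap_(i in [set: 'I_n])
    ((fun x : n.-tuple R => tnth x i) @^-1` `[a i, b i]).
  apply/seteqP; split => x /= H i; first by move=> _; rewrite /= in_itv/=.
  by have := H i I; rewrite /= in_itv/=.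
apply: fin_bigcap_measurable => // i _; rewrite -[X in measurable X]setTI.
exact: measurable_tnth.
Qed.
End IteratedIntegral.

(** * Box data: lower bound for the propagator and bounds for both norms *)

Section BoxData.
Variable R : realType.

Lemma cos_ge_cos1 (x : R) : `|x| <= 1 -> cos 1 <= cos x.
Proof.
move=> x1; have -> : cos x = cos `|x| by case: (ger0P x) => // _; rewrite cosN.
have pi1 : 1 <= pi :> R by apply: le_trans (pi_ge2 R); rewrite ler1n.
by rewrite leNgt ltr_cos ?in_itv/= ?normr_ge0 ?ler01 ?(le_trans x1) // -leNgt.
Qed.

Lemma cmod_ge_Re (z : R[i]) : complex.Re z <= cmod z.
Proof.
rewrite (le_trans (ler_norm _))// -sqrtr_sqr ler_sqrt ?lerDl ?sqr_ge0//.
by rewrite addr_ge0 ?sqr_ge0.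
Qed.

Definition box_data n (a b : nat -> R) (xi : n.-tuple R) : R[i] :=
  (\1_(box a b) xi +i* 0)%C.

Lemma cmod_box_data n (a b : nat -> R) (xi : n.-tuple R) :
  cmod (box_data a b xi) = \1_(box a b) xi.
Proof.
by rewrite /cmod /= expr0n/= addr0 sqrtr_sqr ger0_norm// indicE ler0n.
Qed.

Lemma box_vol_gt0 n (a b : nat -> R) :
  (forall i, a i < b i) -> 0 < box_vol n a b.
Proof. by move=> ab; apply: prodr_gt0 => i _; rewrite subr_gt0. Qed.

(** After multiplication by 2 pi the phase lies in [-1, 1] on the box, so the real part of the
    integrand is at least cos 1 > 0 there and vanishes elsewhere. *)
Lemma wave_prop_box_ge n pm (a b : nat -> R) (x : n.-tuple R) (t : R) :
  (forall i, a i < b i) ->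
  (forall xi : n.-tuple R, box a b xi ->
    `|dotn x xi + (if pm then 1 else -1) * t * normn xi| <= (2 * pi)^-1) ->
  cos 1 * box_vol n a b <= cmod (wave_prop pm (box_data a b) x t).
Proof.
move=> ab phase; apply: le_trans (cmod_ge_Re _).
set th := fun xi : n.-tuple R =>
  2 * pi * (dotn x xi + (if pm then 1 else -1) * t * normn xi).
pose g (xi : n.-tuple R) : R := \1_(box a b) xi * cos (th xi).
have -> : complex.Re (wave_prop pm (box_data a b) x t) = iintR g.
  by congr iintR; apply/funext => xi; rewrite /= mul0r subr0.
rewrite /iintR.
have cos_th xi : box a b xi -> cos 1 <= cos (th xi).
  move=> /phase H; apply: cos_ge_cos1.
  have p0 : 0 < 2 * pi :> R by rewrite mulr_gt0// pi_gt0.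
  by rewrite normrM (gtr0_norm p0) -ler_pdivlMl// mulr1.
have -> : (fun xi : n.-tuple R => (Num.max (- g xi) 0)%:E) =
    (fun xi => (0 * \1_(box a b) xi)%:E).
  apply/funext => xi; rewrite /g mul0r; congr EFin; apply/max_idPr.
  rewrite oppr_le0 indicE; case: (boolP (xi \in _)); rewrite ?mul0r// inE mul1r.
  by move=> /cos_th; apply: le_trans; exact: ltW (cos1_gt0 R).
rewrite iint_box// mul0r subr0.
set F := fun xi : n.-tuple R => _.
have F0 xi : (0 <= F xi)%E by rewrite lee_fin le_max lexx orbT.
(* The upper bound ensures finiteness: [fine] would send an infinite integral to 0. *)
have Fle : (iint F <= (1 * box_vol n a b)%:E)%E.
  rewrite -iint_box//; apply: iint_le => // xi; rewrite lee_fin /g mul1r.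
  rewrite ge_max indicE ler0n andbT.
  by case: (_ \in _); rewrite ?mul0r// mul1r cos_le1.
have leF : ((cos 1 * box_vol n a b)%:E <= iint F)%E.
  rewrite -iint_box ?(ltW (cos1_gt0 R))//; apply: iint_le => xi.
    by rewrite lee_fin mulr_ge0 ?(ltW (cos1_gt0 R))// indicE ler0n.
  rewrite lee_fin /g le_max indicE.
  case: (boolP (xi \in _)); rewrite ?mulr0 ?lexx ?orbT// inE mulr1 mul1r.
  by move=> /cos_th ->.
rewrite -lee_fin fineK// ge0_fin_numE ?iint_ge0//.
exact: le_lt_trans Fle (ltry _).
Qed.

Lemma Hs_norm_box_le n s (a b : nat -> R) (w : R) :
  (forall i, a i < b i) -> 0 <= w ->
  (forall xi : n.-tuple R, box a b xi -> (1 + normn xi) `^ (2 * s) <= w) ->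
  (Hs_norm s (box_data (n := n) a b) <= ((w * box_vol n a b) `^ 2^-1)%:E)%E.
Proof.
move=> ab w0 H; rewrite /Hs_norm -poweR_EFin.
have F0 (xi : n.-tuple R) : (0 <= ((1 + normn xi) `^ (2 * s) *
    cmod (box_data a b xi) ^+ 2)%:E)%E.
  by rewrite lee_fin mulr_ge0 ?powR_ge0 ?sqr_ge0.
have v0 := ltW (@box_vol_gt0 n a b ab).
apply: gt0_ler_poweR; rewrite ?in_itv/= ?leey ?iint_ge0 ?lee_fin ?mulr_ge0//.
rewrite -iint_box//; apply: iint_le => // xi; rewrite lee_fin cmod_box_data.
rewrite indicE; case: (boolP (xi \in _)); rewrite ?expr0n ?mulr0//= inE expr1n !mulr1.
exact: H.
Qed.

Lemma admissible_box n s (a b : nat -> R) (w : R) :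
  (forall i, a i < b i) -> 0 <= w ->
  (forall xi : n.-tuple R, box a b xi -> (1 + normn xi) `^ (2 * s) <= w) ->
  admissible s (box_data (n := n) a b).
Proof.
move=> ab w0 H; split; last split; last split.
- have := @measurable_indic_box R n a b 1.
  by apply: eq_measurable_fun => x _ /=; rewrite mul1r.
- exact: measurable_cst.
- have -> : (fun xi : n.-tuple R => (cmod (box_data a b xi))%:E) =
      (fun xi => (1 * \1_(box a b) xi)%:E).
    by apply/funext => xi; rewrite cmod_box_data mul1r.
  by rewrite iint_box// ltry.
- exact: le_lt_trans (Hs_norm_box_le ab w0 H) (ltry _).
Qed.

Lemma Lq_norm_box_ge n (q : \bar R) (D : set (n.-tuple R))
    (F : n.-tuple R -> \bar R) (c d : nat -> R) (v : R) :
  (1 <= q)%E -> (forall i, c i < d i) -> 0 < v ->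
  box c d `<=` D -> (forall x, box c d x -> (v%:E <= F x)%E) ->
  ((v * box_vol n c d `^ recip_q q)%:E <= Lq_norm q D F)%E.
Proof.
move=> q1 cd v0 cdD vF; have V0 := @box_vol_gt0 n c d cd.
have vF' x : box c d x -> (v%:E <= `|F x|)%E.
  by move=> /vF H; apply: le_trans H (lee_abs _).
case: q q1 => [r| |]//=; last first.
  (* For q = +oo the volume has exponent 0. An essential bound M < v would be exceeded on the whole
     box, which has positive measure. *)
  move=> _; rewrite powRr0 mulr1; apply: le_ereal_inf_tmp => M /= M0.
  rewrite leNgt; apply/negP => Mv.
  suff : ((1 * box_vol n c d)%:E <= 0 :> \bar R)%E.
    by rewrite lee_fin mul1r leNgt V0.
  rewrite -M0 -iint_box//; apply: iint_le => x.
    by rewrite lee_fin mul1r indicE ler0n.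
  rewrite lee_fin mul1r !indicE ler_nat; case: (boolP (x \in _)) => //.
  rewrite inE => Hx; rewrite mem_set//.
  by split; [exact: cdD|exact: lt_le_trans Mv (vF' _ Hx)].
rewrite lee_fin => r1; have r0 : 0 < r by exact: lt_le_trans ltr01 r1.
have -> : v * box_vol n c d `^ r^-1 = (v `^ r * box_vol n c d) `^ r^-1.
  by rewrite powRM ?powR_ge0 ?ltW// -powRrM divff ?gt_eqF// powRr1 ?ltW.
rewrite -poweR_EFin.
have le_int : ((v `^ r * box_vol n c d)%:E <=
  iint (fun x => if `[< D x >] then `|F x| `^ r else 0))%E.
  rewrite -iint_box ?powR_ge0//; apply: iint_le => x.
    by rewrite lee_fin mulr_ge0 ?powR_ge0// indicE ler0n.
  rewrite indicE; case: (boolP (x \in _)); rewrite ?inE ?mulr0 ?mulr1 => Hx.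
    rewrite asboolT; last exact: cdD.
    rewrite -poweR_EFin; apply: gt0_ler_poweR; rewrite ?in_itv/= ?leey ?andbT//.
    - exact: ltW.
    - by rewrite lee_fin ltW.
    - exact: vF'.
  by case: asboolP => // _; exact: poweR_ge0.
have v_ge0 : (0 <= (v `^ r * box_vol n c d)%:E)%E.
  by rewrite lee_fin mulr_ge0 ?powR_ge0 ?ltW.
apply: gt0_ler_poweR; rewrite ?in_itv/= ?leey ?andbT ?invr_ge0//; first exact: ltW.
exact: le_trans v_ge0 le_int.
Qed.
End BoxData.

(** * From the maximal estimate to inequalities between logarithms *)

Section NecessaryConditions.
Variable R : realType.
Implicit Types (s : R) (q : \bar R).

(** The term [|s| * ln K] absorbs the spread of u between P and K P for either sign of s. *)
Lemma powR_le_expR (K P u s : R) : 0 < P -> P <= u <= K * P ->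
  u `^ (2 * s) <= expR (2 * (`|s| * ln K + s * ln P)).
Proof.
move=> P0 /andP[Pu uKP]; have u0 : 0 < u by exact: lt_le_trans P0 Pu.
have K0 : 0 < K by rewrite -(pmulr_lgt0 _ P0) (lt_le_trans u0).
rewrite /powR gt_eqF// ler_expR.
have l1 : ln P <= ln u by rewrite ler_ln ?posrE.
have l2 : ln u <= ln K + ln P by rewrite -lnM ?posrE// ler_ln ?posrE ?mulr_gt0.
have : s * (ln u - ln P) <= `|s| * ln K.
  rewrite (le_trans (ler_wpM2r _ (ler_norm s))) ?subr_ge0//.
  by rewrite ler_wpM2l// lerBlDr.
lra.
Qed.

(** Logarithms of the test inequality make every scaling argument linear. The constant [k] is
    uniform in the boxes and in P, which is what allows the parameters to tend to infinity. *)
Lemma max_estimate_box n q s pm (T : set R) (D : set (n.-tuple R)) :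
  (1 <= q)%E -> max_estimate q s pm T D ->
  exists k : R, forall (a b c d : nat -> R) (P : R),
    (forall i, a i < b i) -> (forall i, c i < d i) -> 0 < P ->
    (forall xi : n.-tuple R, box a b xi ->
       P <= 1 + normn xi <= (2 * n + 1)%:R * P) ->
    box c d `<=` D ->
    (forall x : n.-tuple R, box c d x -> exists2 t, T t &
       forall xi : n.-tuple R, box a b xi ->
       `|dotn x xi + (if pm then 1 else -1) * t * normn xi| <= (2 * pi)^-1) ->
    2^-1 * ln (box_vol n a b) + recip_q q * ln (box_vol n c d) <= k + s * ln P.
Proof.
move=> q1 [C HC]; set K : R := (2 * n + 1)%:R.
(* C may be nonpositive; [M] has a meaningful logarithm. *)
pose M := Num.max C 1.
exists (ln M - ln (cos 1) + `|s| * ln K) => a b c d P ab cd P0 PK cdD phase.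
set w := expR (2 * (`|s| * ln K + s * ln P)).
have w0 : 0 < w by exact: expR_gt0.
have Hw (xi : n.-tuple R) : box a b xi -> (1 + normn xi) `^ (2 * s) <= w.
  by move=> /PK; exact: powR_le_expR.
have V0 := @box_vol_gt0 R n a b ab; have V1 := @box_vol_gt0 R n c d cd.
have c0 := cos1_gt0 R.
have M0 : 0 < M by rewrite lt_max ltr01 orbT.
have sw0 : 0 < (w * box_vol n a b) `^ 2^-1 by rewrite powR_gt0// mulr_gt0.
have : (cos 1 * box_vol n a b * box_vol n c d `^ recip_q q <=
    M * (w * box_vol n a b) `^ 2^-1).
  rewrite -lee_fin.
  have F x : box c d x -> ((cos 1 * box_vol n a b)%:E <=
      wave_max pm T (@box_data R n a b) x)%E.
    move=> /phase[t Tt ph]; apply: ereal_sup_ge; exists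
      (cmod (wave_prop pm (box_data a b) x t))%:E; first by exists t.
    by rewrite lee_fin; exact: wave_prop_box_ge.
  apply: (le_trans (Lq_norm_box_ge q1 cd _ cdD F)); first by rewrite mulr_gt0.
  apply: (le_trans (HC _ (admissible_box ab (ltW w0) Hw))).
  have H0 : (0 <= Hs_norm s (@box_data R n a b))%E by exact: poweR_ge0.
  rewrite EFinM; apply: (@le_trans _ _ (M%:E * Hs_norm s (@box_data R n a b))%E).
    by apply: lee_wpmul2r => //; rewrite lee_fin le_max lexx.
  apply: lee_wpmul2l; first by rewrite lee_fin ltW.
  exact: (Hs_norm_box_le ab (ltW w0) Hw).
rewrite -ler_ln ?posrE ?mulr_gt0 ?powR_gt0 ?mulr_gt0//.
rewrite !lnM ?posrE ?mulr_gt0 ?powR_gt0 ?mulr_gt0// !ln_powR lnM ?posrE// expRK.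
lra.
Qed.

(** Below, u is the logarithm of the large parameter N, so exponents of N are compared as slopes. If
    alpha > sigma, the chosen u would give |gamma - beta| + 1 <= gamma - beta. *)
Lemma affine_le_slope (alpha beta gamma sigma : R) :
  (forall u, 0 <= u -> alpha * u + beta <= gamma + sigma * u) -> alpha <= sigma.
Proof.
move=> H; rewrite leNgt; apply/negP => lt_sa.
have d0 : 0 < alpha - sigma by rewrite subr_gt0.
pose u := (`|gamma - beta| + 1) / (alpha - sigma).
have u0 : 0 <= u by apply: divr_ge0; [apply: addr_ge0|exact: ltW].
have uE : (alpha - sigma) * u = `|gamma - beta| + 1.
  by rewrite mulrC divfK ?gt_eqF.
rewrite mulrBl in uE; have := ler_norm (gamma - beta).
by have := H u u0; lra.
Qed.

(** * Phase bounds and the two families of test boxes *)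

Definition kappa (n : nat) : R := (6 * pi * n%:R)^-1.

Lemma kappa_gt0 n : (0 < n)%N -> 0 < kappa n.
Proof. by move=> n0; rewrite invr_gt0 !mulr_gt0 ?pi_gt0 ?ltr0n. Qed.

(** The phases below split into pieces of total size at most 3 n kappa, which is thus exactly the
    threshold of [max_estimate_box]. *)
Lemma kappa_mul n : (0 < n)%N -> 3 * (n%:R * kappa n) = (2 * pi)^-1.
Proof.
move=> n0; rewrite /kappa; move: (pi : R) (pi_gt0 R) => p p0; field.
by rewrite gt_eqF//= pnatr_eq0 -lt0n.
Qed.

Lemma kappa_small n : (0 < n)%N -> n%:R * kappa n <= 12^-1.
Proof.
move=> n0; have := kappa_mul n0.
have : (2 * pi)^-1 <= 4^-1 :> R.
  by rewrite lef_pV2 ?posrE ?mulr_gt0 ?pi_gt0//; have := pi_ge2 R; lra.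
lra.
Qed.

Lemma kappa_le n : (0 < n)%N -> kappa n <= 12^-1.
Proof.
move=> n0; apply: le_trans (kappa_small n0).
by rewrite ler_peMl ?ler1n// ltW ?kappa_gt0.
Qed.

Lemma normr_sum_le n (x : 'I_n -> R) (r : R) :
  (forall i, `|x i| <= r) -> `|\sum_(i < n) x i| <= n%:R * r.
Proof.
move=> H; apply: le_trans (ler_norm_sum _ _ _) _.
apply: le_trans (ler_sum _ (fun i _ => H i)) _.
by rewrite sumr_const card_ord mulr_natl.
Qed.

Lemma normn_le n (x : n.-tuple R) (r : R) :
  0 <= r -> (forall i, `|tnth x i| <= r) -> normn x <= n%:R * r.
Proof.
case: n x => [|m] x r0 H; first by rewrite /normn big_ord0 sqrtr0 mul0r.
rewrite -[leRHS]ger0_norm ?mulr_ge0// -sqrtr_sqr ler_sqrt ?sqr_ge0//.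
rewrite exprMn.
apply: le_trans (ler_norm _) _; apply: le_trans (@normr_sum_le _ _ (r ^+ 2) _) _.
  by move=> i; rewrite normrX ler_sqr ?nnegrE.
by apply: ler_wpM2r; rewrite ?sqr_ge0// -natrX ler_nat leq_pmulr.
Qed.

Lemma lnX_natmul (x : R) n : 0 < x -> ln (x ^+ n) = n%:R * ln x.
Proof. by move=> x0; rewrite lnXn// mulr_natl. Qed.

(** Frequencies in [0, ep]^n and points in [0, kappa / ep]^n are tested at the single time kappa:
    both x.xi and t|xi| are at most n kappa. Since 1 + |xi| is comparable to P = 1, s drops out. *)
Lemma low_frequency_bound n q s pm (T : set R) :
  (0 < n)%N -> (1 <= q)%E -> max_estimate q s pm T [set: n.-tuple R] ->
  T (kappa n) ->
  exists k : R, forall ep : R, 0 < ep <= 1 ->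
    2^-1 * (n%:R * ln ep) + recip_q q * (n%:R * (ln (kappa n) - ln ep)) <= k.
Proof.
move=> n0 q1 H Tk; have [k Hk] := max_estimate_box q1 H.
have k0 := kappa_gt0 n0; exists k => ep /andP[e0 e1].
have := Hk (fun=> 0) (fun=> ep) (fun=> 0) (fun=> kappa n / ep) 1.
rewrite ln1 mulr0 addr0 /box_vol !prodr_const !card_ord !subr0.
rewrite !lnX_natmul ?divr_gt0// ln_div ?posrE//; apply => //.
- move=> xi Hxi; rewrite lerDl sqrtr_ge0/= mulr1 natrD addrC lerD2r.
  apply: (@le_trans _ _ (n%:R * 1)); last by rewrite mulr1 ler_nat leq_pmull.
  apply: normn_le => // i; have /andP[x0 x1] := Hxi i.
  by rewrite ger0_norm// (le_trans x1).
move=> x Hx; exists (kappa n) => // xi Hxi.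
rewrite -(kappa_mul n0).
have nx : normn xi <= n%:R * 1.
  apply: normn_le => // i; have /andP[x0 x1] := Hxi i.
  by rewrite ger0_norm// (le_trans x1).
have dx : `|dotn x xi| <= n%:R * kappa n.
  apply: normr_sum_le => i; have /andP[x0 x1] := Hx i.
  have /andP[y0 y1] := Hxi i.
  rewrite normrM !ger0_norm//.
  have -> : kappa n = kappa n / ep * ep by rewrite divfK// gt_eqF.
  exact: ler_pM.
rewrite (le_trans (ler_normD _ _))//.
have : `|(if pm then 1 else -1) * kappa n * normn xi| <= n%:R * kappa n.
  rewrite !normrM (gtr0_norm k0) [`|normn xi|]ger0_norm ?sqrtr_ge0//.
  have -> : `|if pm then 1 else -1| = 1 :> R by case: pm {H Hk}; rewrite ?normrN normr1.
  by rewrite mul1r mulrC; apply: ler_wpM2r; [exact: ltW|rewrite mulr1 in nx].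
have : 0 <= n%:R * kappa n by rewrite mulr_ge0// ltW.
by move: dx; lra.
Qed.

(** The difference |xi| - xi_0 equals the sum of the other squares divided by |xi| + xi_0, and this
    denominator is at least A. *)
Lemma normn_sub_head m (xi : m.+1.-tuple R) (A del : R) :
  0 < A <= tnth xi ord0 -> (forall j, 0 <= tnth xi (lift ord0 j) <= del) ->
  tnth xi ord0 <= normn xi /\ (normn xi - tnth xi ord0) * A <= m%:R * del ^+ 2.
Proof.
move=> /andP[A0 Ax] Hdel; set x0 := tnth xi ord0 in Ax *.
have x00 : 0 < x0 by exact: lt_le_trans A0 Ax.
pose S : R := \sum_(j < m) tnth xi (lift ord0 j) ^+ 2.
have S0 : 0 <= S by apply: sumr_ge0 => j _; exact: sqr_ge0.
have Sle : S <= m%:R * del ^+ 2.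
  apply: le_trans (ler_norm _) _; apply: normr_sum_le => j.
  have /andP[y0 y1] := Hdel j; rewrite normrX ger0_norm// ler_sqr ?nnegrE//.
  exact: le_trans y0 y1.
have z0 : 0 <= normn xi by exact: sqrtr_ge0.
have z2 : normn xi ^+ 2 = x0 ^+ 2 + S.
  rewrite sqr_sqrtr; last by apply: sumr_ge0 => j _; exact: sqr_ge0.
  by rewrite big_ord_recl.
have xz : x0 <= normn xi by rewrite -(@ler_sqr _ x0) ?nnegrE ?(ltW x00)// z2 lerDl.
split => //; apply: le_trans Sle.
have -> : S = (normn xi - x0) * (normn xi + x0) by rewrite -subr_sqr z2; ring.
by apply: ler_wpM2l; rewrite ?subr_ge0//; lra.
Qed.

(* Knapp example: the frequencies fill the plate [A, 2A] x [0, del]^m, on which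
   |xi| - xi_0 <= m del^2 / A, so at time t = |x_0| <= 2L the phase stays bounded
   for x_0 of size L (with the sign opposite to that of t|xi|) and
   0 <= x_j <= kappa / del. *)
Lemma knapp_bound m q s pm (T : set R) (D : set (m.+1.-tuple R)) :
  (1 <= q)%E -> max_estimate q s pm T D ->
  exists k : R, forall A del L : R, 1 <= A -> 0 < del -> del <= A -> 0 < L ->
    L * del ^+ 2 <= kappa m.+1 * A ->
    `[L, 2 * L] `<=` T ->
    (forall x : m.+1.-tuple R,
      (forall i, `|tnth x i| <= Num.max (2 * L) (kappa m.+1 / del)) -> D x) ->
    2^-1 * (ln A + m%:R * ln del) +
      recip_q q * (ln L + m%:R * (ln (kappa m.+1) - ln del)) <= k + s * ln A.
Proof.
move=> q1 H; have [k Hk] := max_estimate_box q1 H; exists k.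
move=> A del L A1 del0 delA L0 LA LT HD.
have k0 : 0 < kappa m.+1 by exact: kappa_gt0.
have A0 : 0 < A by exact: lt_le_trans ltr01 A1.
pose a i : R := if i is 0%N then A else 0.
pose b i : R := if i is 0%N then 2 * A else del.
pose c i : R := if i is 0%N then (if pm then - (2 * L) else L) else 0.
pose d i : R := if i is 0%N then (if pm then - L else 2 * L) else kappa m.+1 / del.
have := Hk a b c d A.
have -> : box_vol m.+1 a b = A * del ^+ m.
  rewrite /box_vol big_ord_recl /= prodr_const card_ord subr0; congr (_ * _).
  by rewrite /a/b/=; ring.
have -> : box_vol m.+1 c d = L * (kappa m.+1 / del) ^+ m.
  rewrite /box_vol big_ord_recl /= prodr_const card_ord subr0; congr (_ * _).
  by rewrite /c/d/=; case: (pm); ring.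
rewrite !lnM ?posrE ?exprn_gt0 ?divr_gt0// !lnX_natmul ?divr_gt0// ln_div ?posrE//.
apply => //.
- by case=> [|i] //=; rewrite ltr_pMl// ltr1n.
- by case=> [|i] /=; [case: (pm); rewrite ?ltrN2 ltr_pMl// ltr1n|rewrite divr_gt0].
- move=> xi Hxi; have /andP[x0 x1] := Hxi ord0; rewrite /a/b/= in x0 x1.
  have [] := @normn_sub_head _ xi A del; first by rewrite A0.
    by move=> j; have := Hxi (lift ord0 j).
  move=> z0 z1; apply/andP; split; first by lra.
  (* With 1 <= A and xi_0 <= 2A this leads to 1 + |xi| <= (m + 3) A, within the allowed factor 2 (m
     + 1) + 1. *)
  have d2 : m%:R * del ^+ 2 <= m%:R * A * A.
    rewrite -mulrA -expr2; apply: ler_wpM2l => //.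
    by rewrite ler_sqr// nnegrE ltW.
  have : normn xi - tnth xi ord0 <= m%:R * A.
    by rewrite -(ler_pM2r A0) (le_trans z1).
  rewrite !natrD !natrM -[m.+1%:R]natr1; have : 0 <= m%:R * A by rewrite mulr_ge0 ?(ltW A0).
  by lra.
- move=> x Hx; apply: HD => i; have := Hx i; rewrite /c/d.
  case: (unliftP ord0 i) => [j|] -> /= /andP[x0 x1]; rewrite le_max.
    by rewrite ger0_norm// x1 orbT.
  by apply/orP; left; rewrite ler_norml; case: (pm) x0 x1; lra.
move=> x Hx; have := Hx ord0; rewrite /c/d/= => Hx0.
exists `|tnth x ord0|.
  apply: LT; rewrite /= in_itv/=; case: (pm) Hx0 => /andP[x0 x1].
    by rewrite ltr0_norm; lra.
  by rewrite gtr0_norm; lra.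
move=> xi Hxi; have /andP[y0 y1] := Hxi ord0; rewrite /a/b/= in y0 y1.
have [] := @normn_sub_head _ xi A del; first by rewrite A0.
  by move=> j; have := Hxi (lift ord0 j).
set z := normn xi; set x0 := tnth x ord0 in Hx0 *; set xi0 := tnth xi ord0 in y0 y1 *.
move=> z0 z1.
have sgn : (if pm then 1 else -1) * `|x0| = - x0.
  case: (pm) Hx0 => /andP[u0 u1]; first by rewrite mul1r ltr0_norm; lra.
  by rewrite mulN1r gtr0_norm; lra.
have x0L : `|x0| <= 2 * L by rewrite ler_norml; case: (pm) Hx0; lra.
rewrite sgn -(kappa_mul (ltn0Sn m)) /dotn big_ord_recl -/x0 -/xi0.
set S := \sum_(i < m) _.
have SB : `|S| <= m%:R * kappa m.+1.
  apply: normr_sum_le => j; have /andP[u0 u1] := Hx (lift ord0 j).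
  have /andP[v0 v1] := Hxi (lift ord0 j).
  have c0 : c (lift ord0 j) = 0 by [].
  have a0 : a (lift ord0 j) = 0 by [].
  rewrite c0 in u0; rewrite a0 in v0.
  rewrite normrM !ger0_norm//.
  have -> : kappa m.+1 = kappa m.+1 / del * del by rewrite divfK// gt_eqF.
  exact: ler_pM.
(* The choice t = |x_0| cancels the main term x_0 xi_0. What remains is at most m kappa from [S] and
   2 m kappa from the curvature of the cone. *)
have -> : x0 * xi0 + S + - x0 * z = S - x0 * (z - xi0) by ring.
rewrite (le_trans (ler_normB _ _))// normrM [`|z - xi0|]ger0_norm ?subr_ge0//.
have : `|x0| * (z - xi0) <= 2 * (m%:R * kappa m.+1).
  apply: (@le_trans _ _ (2 * L * (z - xi0))); first by rewrite ler_wpM2r ?subr_ge0.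
  rewrite -(ler_pM2r A0).
  have : L * ((z - xi0) * A) <= L * (m%:R * del ^+ 2).
    by apply: ler_wpM2l => //; exact: ltW.
  have : m%:R * (L * del ^+ 2) <= m%:R * (kappa m.+1 * A) by exact: ler_wpM2l.
  lra.
have := ltW k0; move: SB; rewrite -[m.+1%:R]natr1 [(_ + 1) * _]mulrDl mul1r; lra.
Qed.

(** * Necessary conditions by comparison of growth rates *)

Lemma unit_ball_cube n (x : n.-tuple R) : (0 < n)%N ->
  (forall i, `|tnth x i| <= 2 * kappa n) -> unit_ball x.
Proof.
move=> n0 H; have k0 := kappa_gt0 n0.
have := normn_le (ltW (mulr_gt0 (ltr0Sn _ 1) k0)) H.
by rewrite /unit_ball/=; have := kappa_small n0; lra.
Qed.

(** The inclusions of (0, 1) in [T] and of the unit ball in [D] let one statement serve all four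
    estimates. The tests fit because L <= kappa <= 1/12. *)
Lemma local_necessary m q s pm (T : set R) (D : set (m.+1.-tuple R)) :
  (1 <= q)%E -> `]0, 1[ `<=` T -> @unit_ball R m.+1 `<=` D ->
  max_estimate q s pm T D ->
  [/\ m.+1%:R * (2^-1 - recip_q q) <= s,
      m.+2%:R / 4 - m%:R / 2 * recip_q q <= s & 2^-1 <= s].
Proof.
move=> q1 T01 DB /(knapp_bound q1)[k Hk].
set kp := kappa m.+1 in Hk; set rq := recip_q q in Hk *.
have kp0 : 0 < kp by exact: kappa_gt0.
have kp12 : kp <= 12^-1 by exact: kappa_le.
have TL L : 0 < L -> L <= kp -> `[L, 2 * L] `<=` T.
  move=> L0 Lk t; rewrite /= in_itv/= => /andP[t0 t1]; apply: T01.
  by rewrite /= in_itv/=; lra.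
have DL L del (x : m.+1.-tuple R) : L <= kp -> 1 <= del ->
    (forall i, `|tnth x i| <= Num.max (2 * L) (kp / del)) -> D x.
  move=> Lk d1 H; apply/DB/unit_ball_cube => // i; apply: le_trans (H i) _.
  have d0 : 0 < del by exact: lt_le_trans ltr01 d1.
  have : kp / del <= kp by rewrite ler_pdivrMr// ler_peMr// ltW.
  by rewrite ge_max => h; apply/andP; split; rewrite -/kp; lra.
have e1 (u : R) : 0 <= u -> 1 <= expR u by move=> u0; rewrite -expR0 ler_expR.
have e0 := @expR_gt0 R.
split.
(* Focusing: A = del = e^u and L = kappa e^(-u). *)
- suff : 2^-1 * m.+1%:R - rq * m.+1%:R <= s by lra.
  apply: (@affine_le_slope _ (rq * (m.+1%:R * ln kp)) k) => u u0.
  have /(_ (e1 u u0) (e0 u) (lexx _)) := Hk (expR u) (expR u) (kp * expR (- u)).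
  have L0 : 0 < kp * expR (- u) by rewrite mulr_gt0.
  have Lk : kp * expR (- u) <= kp by rewrite ler_piMr ?(ltW kp0)// -expR0 ler_expR oppr_le0.
  have Ld : kp * expR (- u) * expR u ^+ 2 <= kp * expR u.
    by rewrite expr2 mulrA -[kp * _ * _]mulrA -expRD addNr expR0 mulr1.
  move=> /(_ L0 Ld (TL _ L0 Lk)).
  move=> /(_ (fun x => DL _ _ x Lk (e1 u u0))).
  by rewrite lnM ?posrE// !expRK -[m.+1%:R]natr1; lra.
(* Knapp plate: A = e^(2u), del = e^u and L = kappa; ln A = 2u gives the slope 2s. *)
- suff : 2^-1 * m.+2%:R - rq * m%:R <= 2 * s by lra.
  apply: (@affine_le_slope _ (rq * (m.+1%:R * ln kp)) k) => u u0.
  have u20 : 0 <= 2 * u by exact: mulr_ge0.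
  have uu : expR u <= expR (2 * u) by rewrite ler_expR; lra.
  have Ld : kp * expR u ^+ 2 <= kp * expR (2 * u).
    by rewrite -expRM_natl.
  have := Hk _ _ _ (e1 _ u20) (e0 u) uu kp0 Ld (TL _ kp0 (lexx _))
    (fun x => DL _ _ x (lexx _) (e1 u u0)).
  by rewrite !expRK -[m.+2%:R]natr1 -[m.+1%:R]natr1; lra.
(* Plane wave: A = e^u, del = 1 and L = kappa. The space box is fixed, so q enters only through a
   constant. *)
- apply: (@affine_le_slope _ (rq * (m.+1%:R * ln kp)) k) => u u0.
  have Ld : kp * 1 ^+ 2 <= kp * expR u by rewrite expr1n ler_wpM2l ?e1// ltW.
  have := Hk _ _ _ (e1 _ u0) ltr01 (e1 _ u0) kp0 Ld (TL _ kp0 (lexx _))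
    (fun x => DL _ _ x (lexx _) (lexx _)).
  by rewrite !expRK ln1 -[m.+1%:R]natr1; lra.
Qed.

(** A plate at frequency A = 1 of width del = e^(-u) stays coherent up to times of order e^(2u),
    available since all times are allowed. As ln A = 0, s disappears and the slope is compared with
    0. *)
Lemma global_necessary m q s pm :
  (1 <= q)%E -> max_estimate q s pm [set: R] [set: m.+1.-tuple R] ->
  recip_q q * m.+2%:R <= 2^-1 * m%:R.
Proof.
move=> q1 /(knapp_bound q1)[k Hk].
set kp := kappa m.+1 in Hk; set rq := recip_q q in Hk *.
have kp0 : 0 < kp by exact: kappa_gt0.
suff : rq * m.+2%:R - 2^-1 * m%:R <= 0 by lra.
apply: (@affine_le_slope _ (rq * (m.+1%:R * ln kp)) k) => u u0.
have d1 : expR (- u) <= 1 by rewrite -expR0 ler_expR oppr_le0.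
have L0 : 0 < kp * expR (2 * u) by rewrite mulr_gt0// expR_gt0.
have Ld : kp * expR (2 * u) * expR (- u) ^+ 2 <= kp * 1.
  by rewrite -mulrA -expRM_natl -expRD mulrN subrr expR0.
have := Hk _ _ _ (lexx _) (expR_gt0 _) d1 L0 Ld (fun _ _ => I) (fun _ _ => I).
rewrite lnM ?posrE ?expR_gt0// !expRK ln1 -[m.+2%:R]natr1 -[m.+1%:R]natr1; lra.
Qed.

Lemma unit_time_necessary n q s pm : (0 < n)%N ->
  (1 <= q)%E -> max_estimate q s pm `]0, 1[ [set: n.-tuple R] ->
  recip_q q <= 2^-1.
Proof.
move=> n0 q1 H; have k0 := kappa_gt0 n0.
have [|k Hk] := low_frequency_bound n0 q1 H.
  by rewrite /= in_itv/= k0; have := kappa_le n0; lra.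
set rq := recip_q q in Hk *; set kp := kappa n in Hk k0.
have n0R : 0 < n%:R :> R by rewrite ltr0n.
rewrite -(ler_pM2r n0R).
apply: (@affine_le_slope _ (rq * (n%:R * ln kp)) k) => u u0.
(* With ep = e^(-u), the data contribute slope -n/2 and the space box slope n/q. *)
have := Hk (expR (- u)); rewrite expR_gt0 -{1}expR0 ler_expR oppr_le0 u0.
by move=> /(_ isT); rewrite expRK; lra.
Qed.
End NecessaryConditions.
Unset Implicit Arguments.
Set Strict Implicit.

Theorem theorem3p1 (R : realType) (n : nat) (q : \bar R) (s : R) (pm : bool) :
  (1 <= n)%N -> (1 <= q)%E ->
  (max_estimate q s pm `]0, 1[ [set: n.-tuple R] ->
     (2%:E <= q)%E /\ @s_crit R n q <= s) /\
  (max_estimate q s pm [set: R] [set: n.-tuple R] ->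
     (@q_crit R n <= q)%E /\ (n%:R : R) * (2^-1 - recip_q q) <= s) /\
  (max_estimate q s pm `]0, 1[ (@unit_ball R n) \/
   max_estimate q s pm [set: R] (@unit_ball R n) ->
     Num.max (2^-1) (@s_crit R n q) <= s).
Proof.
case: n => // m _ q1; split; last split.
- move=> H; split.
    have := unit_time_necessary (ltn0Sn m) q1 H.
    case: q q1 {H} => [r| |]//=; rewrite ?leey// !lee_fin => r1.
    by rewrite lef_pV2 ?posrE// (lt_le_trans ltr01 r1).
  have [//|//|h1 h2 _] := local_necessary q1 _ _ H.
  by rewrite /s_crit ge_max h1.
- move=> H; split.
    have := global_necessary q1 H; rewrite /q_crit.
    case: q q1 {H} => [r| |]//=; rewrite ?leey// lee_fin => r1 h.
    have r0 : 0 < r by exact: lt_le_trans ltr01 r1.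
    have h' : m.+2%:R <= 2^-1 * m%:R * r.
      by rewrite -ler_pdivrMr// mulrC.
    (* In dimension 1 the critical exponent is infinite: [h'] reads 2 <= 0, which excludes every
       finite q. *)
    case: m h h' => [|m] _ h'; first by move: h'; rewrite mulr0 mul0r lern0.
    by rewrite /= lee_fin ler_pdivrMr ?ltr0n// mulrC; lra.
  by have [//|//|h1 _ _] := local_necessary q1 _ _ H.
- case=> H.
    have [//|//|h1 h2 h3] := local_necessary q1 _ _ H.
    by rewrite /s_crit !ge_max h1 h2 h3.
  have [//|//|h1 h2 h3] := local_necessary q1 _ _ H.
  by rewrite /s_crit !ge_max h1 h2 h3.
Qed.
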